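(* Let $\mathcal{H}$ be a nonempty hypergraph with no singletons such that $\chi(\operatorname{KG}(\mathcal{H}))=\operatorname{cd}_2(\mathcal{H})=t$. Then any proper coloring of $\operatorname{KG}(\mathcal{H})$ with $t$ colors contains a colorful copy of $K_{t,t}^*$ with all $t$ colors appearing on each side.
   Context: A hypergraph $\mathcal{H}$ is a pair $(V(\mathcal{H}),E(\mathcal{H}))$ where the vertex set $V(\mathcal{H})$ is a nonempty finite set and the edge set $E(\mathcal{H})$ is a finite collection of (nonempty) subsets of $V(\mathcal{H})$. It is nonempty if it has at least one edge. A singleton is an edge with a single vertex. The general Kneser graph $\operatorname{KG}(\mathcal{H})$ is the graph whose vertices are the edges of $\mathcal{H}$, two vertices being adjacent if the corresponding edges are disjoint. $\chi$ denotes the chromatic number. A hypergraph is $2$-colorable if its vertices can be colored with $2$ colors so that no edge is monochromatic. The $2$-colorability defect is $\operatorname{cd}_2(\mathcal{H})=\min\{|U| : U\subseteq V(\mathcal{H}),\ (V(\mathcal{H})\setminus U,\{e\in E(\mathcal{H}): e\cap U=\varnothing\})\text{ is }2\text{-colorable}\}$. $K_{q,q}^*$ is the bipartite graph obtained from the complete bipartite graph $K_{q,q}$ by removing a perfect matching; its two sides have $q$ vertices each. A copy of $K_{q,q}^*$ in a graph is a (not necessarily induced) subgraph isomorphic to it, so its $2q$ vertices are pairwise distinct. Colorful means that all colors appear in the subgraph. *)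

(* Defs.v *)
From mathcomp Require Import all_boot.

Set Implicit Arguments.
Unset Strict Implicit.
Unset Printing Implicit Defensive.

Record sgraph := SGraph {
  svertex :> finType;
  sedge : rel svertex;
  sedge_sym : symmetric sedge;
  sedge_irrefl : irreflexive sedge }.

Definition proper_coloring (G : sgraph) (C : finType) (c : G -> C) : bool :=
  [forall x, forall y, @sedge G x y ==> (c x != c y)].

Definition colorable (G : sgraph) (k : nat) : bool :=
  [exists c : {ffun G -> 'I_k}, proper_coloring c].

Lemma colorable_exists (G : sgraph) : exists k, colorable G k.
Proof.
exists #|G|; apply/existsP; exists [ffun x => enum_rank x].
apply/forallP=> x; apply/forallP=> y; apply/implyP=> xy.
rewrite !ffunE; apply: contraTneq xy => /enum_rank_inj ->.
by rewrite sedge_irrefl.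
Qed.

Definition chromatic_number (G : sgraph) : nat := ex_minn (colorable_exists G).

(* The complete bipartite graph K_{q,q} on the sides [inl] and [inr], with the
   perfect matching { inl i, inr i } removed. *)
Definition Kstar_rel (q : nat) : rel ('I_q + 'I_q) := fun u v =>
  match u, v with
  | inl i, inr j | inr i, inl j => i != j
  | _, _ => false
  end.

Lemma Kstar_sym q : symmetric (@Kstar_rel q).
Proof. by move=> [i|i] [j|j] //=; rewrite eq_sym. Qed.

Lemma Kstar_irrefl q : irreflexive (@Kstar_rel q).
Proof. by case. Qed.

Definition Kstar (q : nat) : sgraph := SGraph (@Kstar_sym q) (@Kstar_irrefl q).

(* Copies are not required to be induced. *)
Definition is_copy (F G : sgraph) (f : F -> G) : Prop :=
  injective f /\ forall u v : F, sedge u v -> sedge (f u) (f v).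

Definition colorful_copy (F G : sgraph) (C : finType) (c : G -> C)
    (f : F -> G) : Prop :=
  is_copy f /\ forall a : C, exists u : F, c (f u) = a.

Record hypergraph := Hypergraph {
  hvertex : finType;
  hedges : {set {set hvertex}};
  hvertex_nonempty : 0 < #|hvertex|;
  hedges_nonempty : set0 \notin hedges }.

Definition kneser_vertex (H : hypergraph) : finType :=
  {e : {set hvertex H} | e \in hedges H}.

Definition kneser_rel (H : hypergraph) : rel (kneser_vertex H) :=
  fun e f => [disjoint val e & val f].

Lemma kneser_sym H : symmetric (@kneser_rel H).
Proof. by move=> e f; rewrite /kneser_rel disjoint_sym. Qed.

Lemma kneser_irrefl H : irreflexive (@kneser_rel H).
Proof.
move=> [e eE]; rewrite /kneser_rel /= -setI_eq0 setIid.
by apply/negbTE; apply: contraNneq (hedges_nonempty H) => <-.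
Qed.

Definition KG (H : hypergraph) : sgraph :=
  SGraph (@kneser_sym H) (@kneser_irrefl H).

Definition monochromatic (V C : finType) (c : V -> C) (e : {set V}) : bool :=
  [exists a, forall x in e, c x == a].

(* For a hypergraph whose vertex set is a subset of [V] containing the members
   of [E]: colors given outside that subset play no role. *)
Definition two_colorable (V : finType) (E : {set {set V}}) : bool :=
  [exists c : {ffun V -> 'I_2}, forall e in E, ~~ monochromatic c e].

Definition edges_avoiding (H : hypergraph) (U : {set hvertex H}) :
    {set {set hvertex H}} :=
  [set e in hedges H | e :&: U == set0].

Lemma cd2_exists (H : hypergraph) : exists k,
  [exists U : {set hvertex H}, two_colorable (edges_avoiding U) && (#|U| == k)].
Proof.
exists #|[set: hvertex H]|; apply/existsP; exists setT; rewrite eqxx andbT.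
apply/existsP; exists [ffun=> ord0]; apply/forall_inP=> e.
rewrite inE setIT => /andP[eE /eqP e0].
by move: (hedges_nonempty H); rewrite -e0 eE.
Qed.

Definition cd2 (H : hypergraph) : nat := ex_minn (cd2_exists H).

(* Main.v *)
Require Import Defs.
From mathcomp Require Import all_boot zify.

Set Implicit Arguments.
Unset Strict Implicit.
Unset Printing Implicit Defensive.

(** Let [V] be the vertex set, [n = #|V|] and [m = n - t]. A signed set [X] is a
    pair of disjoint subsets [X+], [X-] of [V]; let [phi X] be the signed set of
    colors of the edges contained in [X+] (positively) or in [X-] (negatively).
    Then [phi] is monotone and antipodal, and [phi X] is nonempty as soon as
    [|X| > m], because [cd2 = t].

    A complete flag [X_1 < ... < X_n] of signed sets has, for every [k], exactly
    one neighbor differing from it only in [X_k]. Hence the parity of the number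
    of flags satisfying one condition per level does not change when the
    condition on a single level is negated. With an induction over hemispheres
    this gives Fan's lemma: for an antipodal sign function, an odd number of
    flags has alternating signs. For the sign of the largest color in [phi X],
    the top [t] levels of an alternating flag are forced to map onto a fixed
    complete flag of signed colors, and [phi (X_m)] to be empty. So some [S] of
    size [m] with [phi S] empty lies under an odd number of flags that map onto
    that target flag. This local degree modulo 2 is invariant under adjacent
    swaps in the target flag and under reversing all its signs, so each signed
    color [x] starts a target flag that is attained: there is a signed vertex
    [y] with [phi (S + y) = {x}].

    For a color [a] this yields vertices [v], [v'] and edges [e] in [S+ + v],
    [e'] in [S- + v'] of color [a]. As [e] and [e'] share their color they meet,
    so [v = v'], and distinct colors give distinct vertices. The edges [e] and
    [e'] form the two sides of the copy; [e = e'] would be the singleton [v]. *)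

(** * Flags of signed sets *)

Section SeqUpdates.
Variable T : eqType.
Implicit Types (s : seq T) (x y : T) (f : T -> T).

(** Entries are numbered from 0, so on a flag this changes only the member of size [k + 1]. *)
Fixpoint swapn k s : seq T :=
  match k, s with
  | 0, x :: y :: s' => y :: x :: s'
  | k'.+1, x :: s' => x :: swapn k' s'
  | _, _ => s
  end.

Fixpoint mapat f k s : seq T :=
  match k, s with
  | 0, x :: s' => f x :: s'
  | k'.+1, x :: s' => x :: mapat f k' s'
  | _, _ => s
  end.

Lemma size_swapn k s : size (swapn k s) == size s.
Proof.
elim: k s => [|k IH] [|x s] //=; first by case: s => [|y s] /=.
by rewrite eqSS IH.
Qed.

Lemma swapnK k : involutive (swapn k).
Proof. by elim: k => [|k IH] [|x s] //=; [case: s => //= | rewrite IH]. Qed.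

Lemma perm_swapn k s : perm_eq (swapn k s) s.
Proof.
elim: k s => [|k IH] [|x s] //=; last by rewrite perm_cons.
case: s => [|y s] //=; exact/permPl/(perm_catCA [:: y] [:: x]).
Qed.

Lemma swapn_neq k s : uniq s -> k.+1 < size s -> swapn k s != s.
Proof.
elim: k s => [|k IH] [|x s] //=.
  case: s => [|y s] //= /andP[/norP[xy _] _] _.
  by rewrite eqseq_cons eq_sym negb_and xy.
by case/andP=> _ us lt_k; rewrite eqseq_cons eqxx; apply: IH.
Qed.

Lemma perm_take_swapn k i s :
  i != k.+1 -> perm_eq (take i (swapn k s)) (take i s).
Proof.
elim: k i s => [|k IH] [|i] [|x s] ik; rewrite ?take0 //=.
  case: s => [|y s] /=; first by rewrite perm_refl.
  case: i ik => [|i] //= _.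
  exact/permPl/(perm_catCA [:: y] [:: x]).
by rewrite perm_cons IH.
Qed.

Lemma size_mapat f k s : size (mapat f k s) == size s.
Proof. by elim: k s => [|k IH] [|x s] //=; rewrite eqSS IH. Qed.

Lemma mapatK f k : involutive f -> involutive (mapat f k).
Proof. by move=> fK; elim: k => [|k IH] [|x s] //=; rewrite ?fK ?IH. Qed.

Lemma mapat_neq f k s :
  (forall x, f x != x) -> k < size s -> mapat f k s != s.
Proof.
move=> fN; elim: k s => [|k IH] [|x s] //= lt_k; rewrite eqseq_cons.
  by rewrite negb_and fN.
by rewrite eqxx IH.
Qed.

Lemma take_mapat f k i s : i <= k -> take i (mapat f k s) = take i s.
Proof.
by elim: k i s => [|k IH] [|i] [|x s] ik //=; rewrite ?take0 ?IH.
Qed.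

End SeqUpdates.

Lemma map_mapat (T U : eqType) (f : T -> T) (g : T -> U) k s :
  g \o f =1 g -> map g (mapat f k s) = map g s.
Proof.
by move=> gf; elim: k s => [|k IH] [|x s] //=; rewrite ?IH // [g (f x)]gf.
Qed.

(** [f] exchanges the elements that precede their partner with those that follow it, so both halves
    have the same parity. *)
Lemma xor_involution (T : finType) (P : pred T) (f : T -> T) :
    involutive f -> (forall x, P (f x) = P x) -> (forall x, P x -> f x != x) ->
  \big[addb/false]_x P x = false.
Proof.
move=> fK Pf fN; pose lt_f x := enum_rank x < enum_rank (f x).
transitivity (\big[addb/false]_x (P x && lt_f x (+) P (f x) && lt_f (f x))).
  apply: eq_bigr => x _; rewrite Pf -andb_addr /lt_f fK.
  case: (boolP (P x)) => //= Px; case: ltngtP => // /ord_inj/enum_rank_inj E.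
  by move: (fN x Px); rewrite -E eqxx.
rewrite big_split /=.
rewrite -(@reindex_inj _ _ _ _ f predT (fun x => P x && lt_f x) (inv_inj fK)).
by rewrite addbb.
Qed.

Lemma xor_exists (T : finType) (P : pred T) :
  \big[addb/false]_x P x -> exists x, P x.
Proof.
move=> sumP; apply/existsP; apply: contraTT sumP => /existsPn P0.
by rewrite big1 // => x _; apply/negbTE.
Qed.

Section Levels.
Variable V : finType.
Implicit Types (s : seq (V * bool)) (X Y : {set V * bool}).

Definition opps (x : V * bool) := (x.1, ~~ x.2).

(* A flag is encoded by the sequence of the signed elements added one at a
   time, and [lev i s] is its member of size [i]. *)
Definition lev i s : {set V * bool} := [set x in take i s].

(** Expresses that [X+] and [X-] are disjoint. *)
Definition consistent X := {in X &, injective fst}.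

Lemma oppsK : involutive opps.
Proof. by case=> v b; rewrite /opps /= negbK. Qed.

Lemma opps_neq x : opps x != x.
Proof. by case: x => v [] /=; apply/eqP=> -[]. Qed.

Lemma lev0 s : lev 0 s = set0.
Proof. by apply/setP=> x; rewrite !inE take0. Qed.

Lemma lev_oversize s i : size s <= i -> lev i s = [set x in s].
Proof. by move=> si; rewrite /lev take_oversize. Qed.

Lemma lev_S s i x0 : i < size s -> lev i.+1 s = nth x0 s i |: lev i s.
Proof.
by move=> lt_i; apply/setP=> x; rewrite !inE (take_nth x0) // mem_rcons inE.
Qed.

Lemma lev_mono s i j : i <= j -> lev i s \subset lev j s.
Proof.
move=> ij; apply/subsetP=> x; rewrite !inE -(take_takel s ij).
exact: mem_take.
Qed.

Lemma lev_perm i s s' : perm_eq (take i s) (take i s') -> lev i s = lev i s'.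
Proof. by move=> /perm_mem E; apply/setP=> x; rewrite !inE E. Qed.

Lemma consistent_sub X Y : X \subset Y -> consistent Y -> consistent X.
Proof. by move=> /subsetP sXY; apply: sub_in2. Qed.

Lemma consistent_lev i s : uniq (unzip1 s) -> consistent (lev i s).
Proof.
move=> us; have: {in s &, injective fst}.
  elim: s us => //= x s IH /andP[xs us] y z; rewrite !inE.
  case/predU1P=> [->|ys] /predU1P[->|zs] // E; last exact: IH.
    by rewrite E map_f in xs.
  by rewrite -E map_f in xs.
by apply: sub_in2 => x; rewrite inE; apply: mem_take.
Qed.

Lemma card_lev i s : uniq (unzip1 s) -> i <= size s -> #|lev i s| = i.
Proof.
move=> /map_uniq us le_i.
by rewrite cardsE (card_uniqP (take_uniq _ us)) size_takel.
Qed.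

Lemma notin_lev_S i s x0 :
  uniq (unzip1 s) -> i < size s -> nth x0 s i \notin lev i s.
Proof.
move=> us lt_i; apply/negP=> x_in.
have := card_lev us lt_i; rewrite (lev_S x0 lt_i) (setUidPr _) ?sub1set //.
by rewrite card_lev ?(ltnW lt_i) // => /n_Sn.
Qed.

Lemma lev_opps i s : lev i (map opps s) = opps @: lev i s.
Proof.
apply/setP=> x; rewrite inE -map_take.
apply/mapP/imsetP=> -[y]; first by move=> ys ->; exists y; rewrite ?inE.
by rewrite inE => ys ->; exists y.
Qed.

End Levels.

(** * Counting flags modulo 2 with one condition per level *)

Section FlagParity.
Variables (V : finType) (n : nat).
Implicit Types (s : n.-tuple (V * bool)) (B : pred (n.-tuple (V * bool))).
Implicit Types (F : nat -> pred {set V * bool}) (p q r : pred {set V * bool}).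

Definition levels F s := [forall i : 'I_n.+1, F i (lev i s)].

Definition levels_off k F s :=
  [forall i : 'I_n.+1, (i != k :> nat) ==> F i (lev i s)].

Definition flag_parity B F : bool := \big[addb/false]_s (B s && levels F s).

Definition upd k p F : nat -> pred {set V * bool} :=
  fun i => if i == k then p else F i.

Lemma levelsP F s : reflect (forall i, i <= n -> F i (lev i s)) (levels F s).
Proof.
apply: (iffP forallP) => [Fs i le_i | Fs i]; last by apply: Fs; rewrite -ltnS.
exact: (Fs (Ordinal (le_i : i < n.+1))).
Qed.

Lemma levels_offP k F s :
  reflect (forall i, i <= n -> i != k -> F i (lev i s)) (levels_off k F s).
Proof.
apply: (iffP forallP) => [Fs i le_i ik | Fs i].
  exact: (implyP (Fs (Ordinal (le_i : i < n.+1)))).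
by apply/implyP; apply: Fs; rewrite -ltnS.
Qed.

Lemma levels_upd k p F s :
  k <= n -> levels (upd k p F) s = p (lev k s) && levels_off k F s.
Proof.
move=> le_k; apply/levelsP/andP=> [Fs | [pk /levels_offP Fs] i le_i].
  split; first by have := Fs k le_k; rewrite /upd eqxx.
  by apply/levels_offP=> i le_i /negbTE ik; have := Fs i le_i; rewrite /upd ik.
by rewrite /upd; case: eqP => [->|/eqP ik] //; apply: Fs.
Qed.

Lemma eq_flag_parity B F G :
    (forall s, B s -> levels F s = levels G s) ->
  flag_parity B F = flag_parity B G.
Proof.
move=> FG; apply: eq_bigr => s _.
by case: (boolP (B s)) => //= Bs; apply: FG.
Qed.

Lemma flag_parity0 B F :
  (forall s, B s -> ~~ levels F s) -> flag_parity B F = false.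
Proof.
move=> F0; rewrite /flag_parity big1 // => s _.
by case: (boolP (B s)) => //= Bs; apply/negbTE/F0.
Qed.

Lemma flag_parity_exists B F : flag_parity B F -> exists2 s, B s & levels F s.
Proof. by move/xor_exists=> [s /andP[]]; exists s. Qed.

Lemma flag_parity_split k B F p q r :
    k <= n ->
    (forall s, B s -> levels_off k F s ->
       p (lev k s) = q (lev k s) (+) r (lev k s)) ->
  flag_parity B (upd k p F) =
    flag_parity B (upd k q F) (+) flag_parity B (upd k r F).
Proof.
move=> le_k pE; rewrite -big_split /=; apply: eq_bigr => s _.
rewrite !levels_upd //; case: (boolP (B s)) => //= Bs.
case: (boolP (levels_off k F s)) => [Fs|]; last by rewrite !andbF.
by rewrite !andbT pE.
Qed.

(** [f] pairs flags that differ only in level [k], which carries no condition. *)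
Lemma flag_parity_free k B F (f : seq (V * bool) -> seq (V * bool)) :
    involutive f -> (forall s, size (f s) == size s) ->
    (forall s (s' : n.-tuple _), val s' = f s -> B s' = B s) ->
    (forall s, B s -> f s != s) ->
    (forall i s, i <= n -> i != k -> lev i (f s) = lev i s) ->
  k <= n -> flag_parity B (upd k predT F) = false.
Proof.
move=> fK fsz fB fN flev le_k.
have fP (s : n.-tuple _) : size (f s) == n by rewrite (eqP (fsz s)) size_tuple.
pose g s := Tuple (fP s); apply: (@xor_involution _ _ g).
- by move=> s; apply: val_inj; rewrite /= fK.
- move=> s; rewrite (fB s) //; congr (_ && _).
  rewrite !levels_upd //=; apply: eq_forallb => i.
  by case: (altP (_ =P k)) => //= ik; rewrite flev // -ltnS.
- by move=> s /andP[Bs _]; apply: contraNneq (fN s Bs) => /(congr1 val) /= ->.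
Qed.

(** Below the top, the other neighbor of a flag adds the two elements around level [k] in the
    opposite order. *)
Lemma flag_parity_swap k B F :
    0 < k < n ->
    (forall s (s' : n.-tuple _), val s' = swapn k.-1 s -> B s' = B s) ->
    (forall s, B s -> uniq (unzip1 s)) ->
  flag_parity B (upd k predT F) = false.
Proof.
case: k => // k /= lt_k fB uB; apply: (@flag_parity_free _ B F (swapn k)) => //.
- exact: swapnK.
- by move=> s; apply: size_swapn.
- by move=> s /uB /map_uniq us; apply: swapn_neq; rewrite ?size_tuple.
- by move=> i s _ ik; apply/lev_perm/perm_take_swapn.
- exact: ltnW.
Qed.

(** At the top level, the other neighbor gives the last element the opposite sign. *)
Lemma flag_parity_last B F :
    0 < n ->
    (forall s (s' : n.-tuple _),
       val s' = mapat (@opps V) n.-1 s -> B s' = B s) ->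
  flag_parity B (upd n predT F) = false.
Proof.
move=> n_gt0 fB; apply: (@flag_parity_free _ B F (mapat (@opps V) n.-1)) => //.
- exact/mapatK/oppsK.
- by move=> s; apply: size_mapat.
- move=> s _; apply: mapat_neq; first exact: opps_neq.
  by rewrite size_tuple prednK.
- move=> i s le_i ik; rewrite /lev take_mapat // -ltnS prednK //.
  by rewrite ltn_neqAle ik.
Qed.

(** The counts for [p] and [predC p] add up to the count without condition on level [k], which is
    even. *)
Lemma flag_parity_negate k B F p :
    k <= n -> flag_parity B (upd k predT F) = false ->
  flag_parity B (upd k p F) = flag_parity B (upd k (predC p) F).
Proof.
move=> le_k E; move: E; rewrite (flag_parity_split (q := p) (r := predC p)) //.
  by case: flag_parity; case: flag_parity.
by move=> s _ _; rewrite /= addbN addbb.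
Qed.

End FlagParity.

Section FlagSigns.
Variables (V : finType) (n : nat).
Implicit Types (B : pred (n.-tuple (V * bool))).
Implicit Types (F G : nat -> pred {set V * bool}).

Definition free_level k B :=
  forall F, flag_parity B (upd k predT F) = false.

Lemma flag_parity_signs (e : pred nat) B F G :
    (forall k, k <= n -> e k -> free_level k B) ->
    (forall k, k <= n -> forall X, G k X = e k (+) F k X) ->
  flag_parity B F = flag_parity B G.
Proof.
(* The levels are treated one at a time: [H j] has the conditions of [G] below level [j] and those
   of [F] from there on. *)
move=> free GE; pose H j i := if i < j then G i else F i.
transitivity (flag_parity B (H n.+1)); last first.
  apply: eq_flag_parity => s _; apply: eq_forallb => i.
  by rewrite /H ltn_ord.
have: forall j, j <= n.+1 -> flag_parity B F = flag_parity B (H j).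
  elim=> [|j IH] le_j; first by apply: eq_flag_parity.
  rewrite {}IH 1?ltnW //.
  have eqH p : p =1 H j.+1 j ->
      flag_parity B (upd j p (H j)) = flag_parity B (H j.+1).
    move=> pE; apply: eq_flag_parity => s _; apply: eq_forallb => i.
    rewrite /upd; case: eqP => [->|/eqP ij]; first exact: pE.
    by rewrite /H [i < j.+1]ltnS [i <= j]leq_eqVlt (negbTE ij).
  transitivity (flag_parity B (upd j (F j) (H j))).
    apply: eq_flag_parity => s _; apply: eq_forallb => i.
    by rewrite /upd; case: eqP => // ->; rewrite /H ltnn.
  case: (boolP (e j)) => ej; last first.
    by apply: eqH => X; rewrite /H ltnSn (GE j le_j) (negbTE ej).
  rewrite (flag_parity_negate _ _ (free j _ ej _)) //.
  by apply: eqH => X; rewrite /H ltnSn (GE j le_j) ej.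
by apply.
Qed.

End FlagSigns.

(** * Fan's lemma *)

Section Fan.
Variable V : finType.
Implicit Types (W : seq V).

(** [W] is a list so that Fan's lemma can remove its elements one by one. *)
Definition is_flag W (s : seq (V * bool)) := perm_eq (unzip1 s) W.

Lemma is_flag_uniq W (s : seq (V * bool)) :
  uniq W -> is_flag W s -> uniq (unzip1 s).
Proof. by move=> uW /perm_uniq ->. Qed.

Lemma is_flag_swapn W k (s : seq (V * bool)) :
  is_flag W (swapn k s) = is_flag W s.
Proof. by exact: (permPl (perm_map _ (perm_swapn k s))). Qed.

Lemma unzip1_mapat k s : unzip1 (mapat (@opps V) k s) = unzip1 s.
Proof. exact: map_mapat. Qed.

Lemma is_flag_opps W (s : seq (V * bool)) :
  is_flag W (map (@opps V) s) = is_flag W s.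
Proof. by rewrite /is_flag /unzip1 -map_comp. Qed.

Lemma free_flag W k : uniq W -> 0 < k <= size W ->
  free_level k (is_flag W : pred ((size W).-tuple _)).
Proof.
move=> uW /andP[k_gt0]; rewrite leq_eqVlt => /predU1P[kE|lt_k] F.
  rewrite kE in k_gt0 *; apply: flag_parity_last => // s s' E.
  by rewrite /= /is_flag E unzip1_mapat.
apply: flag_parity_swap => [|s s' E|s]; first by rewrite k_gt0.
  by rewrite /= E is_flag_swapn.
exact: is_flag_uniq.
Qed.

Definition antipodal (sg : pred {set V * bool}) :=
  forall X, X != set0 -> consistent X -> sg (@opps V @: X) = ~~ sg X.

(** Level 0 is the empty set, where [antipodal] says nothing, so it carries no condition. *)
Definition word (sg : pred {set V * bool}) (a : pred nat) :
    nat -> pred {set V * bool} :=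
  fun i X => (i == 0) || (sg X == a i).

(** Induction on the ground set. Once both hemispheres of [w] are moved to the positive one, their
    counts add up to a count without top condition. There all flags cancel in pairs except those
    ending in [(w, true)], which are the flags of [W]. *)
Lemma fan W sg a : uniq W -> antipodal sg ->
  flag_parity (is_flag W : pred ((size W).-tuple _)) (word sg a).
Proof.
move=> + sgN; elim: W a => [|w W IH] a.
  move=> _; rewrite /flag_parity (bigD1 [tuple]) //= big1 => [|s].
    by rewrite addbF; apply/levelsP=> -[].
  by case/eqP; exact: tuple0.
move=> /= /andP[wW uW]; have uwW : uniq (w :: W) by rewrite /= wW.
pose n := size W.
pose B b : pred (n.+1.-tuple (V * bool)) :=
  fun s => is_flag (w :: W) s && ((w, b) \in (s : seq _)).
have in_w (s : n.+1.-tuple (V * bool)) : is_flag (w :: W) s ->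
    (w, false) \in (s : seq _) = ((w, true) \notin (s : seq _)).
  move=> fs; have us := is_flag_uniq uwW fs.
  have con : consistent [set x in s].
    rewrite -(@lev_oversize _ s n.+1) ?size_tuple //; exact: consistent_lev.
  have : w \in unzip1 s by rewrite (perm_mem fs) inE eqxx.
  case/mapP=> -[v b] sx /= wv; rewrite -{}wv in sx.
  apply/idP/idP=> [s0|/negP s1]; last by case: b sx.
  apply/negP=> s1; have := con (w, true) (w, false).
  by rewrite !inE => /(_ s1 s0 erefl).
have uB b s : B b s -> uniq (unzip1 s) by case/andP=> /is_flag_uniq ->.
have freeB b k : 0 < k < n.+1 -> free_level k (B b).
  move=> lt_k F; apply: flag_parity_swap => //; last exact: uB.
  move=> s s' E; rewrite /B E is_flag_swapn.
  by rewrite (perm_mem (perm_swapn _ _)).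
(* negating all signs exchanges the hemispheres *)
have BN : flag_parity (B false) (word sg a) =
          flag_parity (B true) (word sg (predC a)).
  have oP (s : n.+1.-tuple (V * bool)) : size (map (@opps V) s) == n.+1.
    by rewrite size_map size_tuple.
  have oI : injective (fun s : n.+1.-tuple (V * bool) => Tuple (oP s)).
    by move=> s s' [] /(inj_map (inv_inj (@oppsK V))) /val_inj.
  rewrite /flag_parity (reindex_inj oI) /=; apply: eq_bigr => s _.
  rewrite /B /= is_flag_opps; have -> : (w, false) = opps (w, true) by [].
  rewrite (mem_map (inv_inj (@oppsK V))).
  case: (boolP (is_flag _ _ && _)) => //= /andP[fs _]; apply: eq_forallb => i.
  rewrite /word /= lev_opps; case: eqP => //= /eqP i0.
  have us := is_flag_uniq uwW fs.
  rewrite sgN; first by case: (sg _); case: (a i).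
    by rewrite -card_gt0 card_lev ?lt0n ?size_tuple -1?ltnS.
  exact: consistent_lev.
(* Inside a hemisphere the levels 1 to [n] are free, so [predC a] can be turned back into [a] there.
   The top level keeps its negation: changing the last sign may leave the hemisphere. *)
pose a' i := if i == n.+1 then ~~ a i else a i.
have {}BN : flag_parity (B false) (word sg a) =
          flag_parity (B true) (word sg a').
  rewrite BN; apply: (@flag_parity_signs _ _ (fun i => 0 < i < n.+1)).
    by move=> k _; apply: freeB.
  move=> [|k] //= le_k X; rewrite /word /a' eqSS /= ltnS ltn_neqAle.
  rewrite [k <= n]le_k andbT.
  by case: (k =P n) => /=; case: (sg _); case: (a _).
have -> : flag_parity (is_flag (w :: W) : pred (n.+1.-tuple (V * bool)))
     (word sg a) =
   flag_parity (B true) (word sg a) (+) flag_parity (B false) (word sg a).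
  rewrite /flag_parity -big_split; apply: eq_bigr => s _ /=; rewrite /B.
  case: (boolP (is_flag _ _)) => //= fs; rewrite in_w //.
  by case: (_ \in _); rewrite /= ?addbF.
rewrite {}BN.
have updW b : word sg b =2 upd n.+1 (fun X => sg X == b n.+1) (word sg b).
  by move=> i X; rewrite /upd; case: eqP => [->|].
have -> : flag_parity (B true) (word sg a) (+) flag_parity (B true) (word sg a')
    = flag_parity (B true) (upd n.+1 predT (word sg a)).
  symmetry; rewrite (@flag_parity_split _ _ _ _ _ _ (fun X => sg X == a n.+1)
    (fun X => sg X == a' n.+1)) //; last first.
    by move=> s _ _; rewrite /a' eqxx; case: (sg _); case: (a _).
  congr (_ (+) _); apply: eq_flag_parity => s _; apply: eq_forallb => i.
    by rewrite [RHS]updW.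
  by rewrite [RHS]updW /upd /word /a'; case: eqP.
(* In [Bi] the element [w] is not last, so changing the last sign preserves [Bi]; in [Bl] it is
   last. *)
pose Bi : pred (n.+1.-tuple (V * bool)) :=
  fun s => is_flag (w :: W) s && ((w, true) \in take n s).
pose Bl : pred (n.+1.-tuple (V * bool)) :=
  fun s => is_flag (w :: W) s && (last (w, true) s == (w, true)).
have -> : flag_parity (B true) (upd n.+1 predT (word sg a)) =
  flag_parity Bi (upd n.+1 predT (word sg a)) (+)
  flag_parity Bl (upd n.+1 predT (word sg a)).
  rewrite /flag_parity -big_split; apply: eq_bigr => s _ /=.
  rewrite /B /Bi /Bl; case: (boolP (is_flag _ _)) => //= fs.
  have /map_uniq := is_flag_uniq uwW fs; move: (levels _ s) => L.
  case: s {fs} => s /= /eqP; case/lastP: s => // s x.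
  rewrite size_rcons => -[<-]; rewrite -cats1 take_size_cat // cats1 last_rcons.
  rewrite rcons_uniq mem_rcons inE eq_sym => /andP[xs _].
  case: eqP => [<-|_]; first by rewrite (negbTE xs).
  by rewrite addbF.
rewrite flag_parity_last //=; last first.
  by move=> s s' E; rewrite /Bi E take_mapat // /is_flag unzip1_mapat.
suff -> : flag_parity Bl (upd n.+1 predT (word sg a)) =
    flag_parity (is_flag W : pred (n.-tuple (V * bool))) (word sg a).
  exact: IH.
rewrite /flag_parity.
rewrite (bigID (fun s : n.+1.-tuple (V * bool) =>
                  last (w, true) s == (w, true))) /=.
rewrite [X in _ (+) X]big1 ?addbF => [|s /negbTE E]; last first.
  by rewrite /Bl E andbF.
pose h' (s : n.+1.-tuple (V * bool)) : n.-tuple _ :=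
  [tuple of belast (thead s) (behead s)].
rewrite (@reindex_onto _ _ _ _ _ (fun s => rcons_tuple s (w, true)) h') /=.
  apply: eq_big => [s|s _].
    rewrite last_rcons eqxx /=; apply/eqP/val_inj => /=.
    by case: s => -[|x s] sz //=; rewrite belast_rcons.
  rewrite /Bl /= last_rcons eqxx andbT; congr (_ && _).
    by rewrite /is_flag /unzip1 map_rcons perm_rcons perm_cons.
  rewrite levels_upd //=; apply/levels_offP/levelsP=> sW i le_i.
    have := sW i (leqW le_i).
    by rewrite /lev /= -cats1 takel_cat ?size_tuple //; apply; rewrite ltn_eqF.
  move=> ni; have {}le_i : i <= n by rewrite -ltnS ltn_neqAle ni.
  by have := sW i le_i; rewrite /lev /= -cats1 takel_cat ?size_tuple.
move=> s /eqP l_s; apply: val_inj => /=.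
by case/tupleP: s l_s => x s /= <-; rewrite theadE -lastI.
Qed.

End Fan.

(** * The local degree *)

Section PickSign.
Variable V : finType.
Implicit Types X : {set V * bool}.

Lemma mem_opps X x : (x \in @opps V @: X) = (opps x \in X).
Proof. by rewrite -{1}[x]oppsK mem_imset //; apply: inv_inj (@oppsK V). Qed.

Lemma consistent_neg X v b :
  consistent X -> (v, b) \in X -> (v, ~~ b) \notin X.
Proof.
move=> con vX; apply/negP=> vX'.
by have [] := con _ _ vX vX' erefl; case: b {vX vX'}.
Qed.

(* Used where [phi X] is empty: any antipodal function would do. *)
Definition pick_sign X : bool :=
  if [pick v | ((v, true) \in X) || ((v, false) \in X)] is Some v
  then (v, true) \in X else false.

Lemma antipodal_pick_sign : antipodal pick_sign.
Proof.
move=> X X0 con; rewrite /pick_sign.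
rewrite (@eq_pick _ _ (fun v => ((v, true) \in X) || ((v, false) \in X))).
  case: pickP => [v vX|noX].
    rewrite mem_opps /opps /=; case/orP: vX => vX; first last.
      by rewrite vX (negbTE (consistent_neg con vX)).
    by rewrite vX (negbTE (consistent_neg con vX)).
  by case/set0Pn: X0 => -[v []] vX; have := noX v; rewrite vX ?orbT.
by move=> v; rewrite /= !mem_opps orbC.
Qed.

End PickSign.

Section Chen.
Variables (V : finType) (W : seq V) (m t : nat).
Variable phi : {set V * bool} -> {set 'I_t * bool}.
Hypothesis uW : uniq W.
Hypothesis sizeW : size W = m + t.
Hypothesis phi_mono : forall X Y : {set V * bool},
  X \subset Y -> phi X \subset phi Y.
Hypothesis phi_con : forall X : {set V * bool},
  consistent X -> consistent (phi X).
Hypothesis phi_opps : forall X : {set V * bool},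
  phi (@opps V @: X) = @opps _ @: phi X.
Hypothesis phi_neq0 : forall X : {set V * bool},
  consistent X -> m < #|X| -> phi X != set0.

Implicit Types (X Y S : {set V * bool}) (l : seq ('I_t * bool)).
Implicit Types (s : (size W).-tuple (V * bool)).
Implicit Types (F : nat -> pred {set V * bool}).

Let flag : pred ((size W).-tuple (V * bool)) := fun s => is_flag W s.

Lemma flag_uniq s : flag s -> uniq (unzip1 s).
Proof. exact: is_flag_uniq. Qed.

Lemma flag_con s i : flag s -> consistent (lev i s).
Proof. by move=> /flag_uniq; apply: consistent_lev. Qed.

Lemma phi_lev_neq0 s i : flag s -> m < i <= m + t -> phi (lev i s) != set0.
Proof.
move=> fs /andP[lt_i le_i]; apply: phi_neq0; first exact: flag_con.
by rewrite card_lev ?size_tuple ?sizeW //; apply: flag_uniq.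
Qed.

Lemma phi_lev_sub s i j : i <= j -> phi (lev i s) \subset phi (lev j s).
Proof. by move=> ij; apply/phi_mono/lev_mono. Qed.

Lemma flag_parity_flip k p F : 0 < k <= m + t ->
  flag_parity flag (upd k p F) = flag_parity flag (upd k (predC p) F).
Proof.
rewrite -sizeW => lt_k; apply: flag_parity_negate; first by case/andP: lt_k.
exact: free_flag.
Qed.

Lemma upd_id k F : upd k (F k) F =2 F.
Proof. by move=> i X; rewrite /upd; case: eqP => [->|]. Qed.

Lemma eq2_flag_parity F G : F =2 G -> flag_parity flag F = flag_parity flag G.
Proof.
by move=> FG; apply: eq_flag_parity => s _; apply: eq_forallb => i; apply: FG.
Qed.

Lemma interval1 (T : finType) (A Y : {set T}) x :
  A \subset Y -> Y \subset x |: A -> Y = A \/ Y = x |: A.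
Proof.
move=> sAY sYA; case: (boolP (x \in Y)) => xY; [right | left].
  by apply/eqP; rewrite eqEsubset sYA subUset sub1set xY.
apply/eqP; rewrite eqEsubset sAY andbT; apply/subsetP=> z zY.
move: (subsetP sYA z zY); rewrite !inE => /predU1P[E|//].
by rewrite -E zY in xY.
Qed.

Lemma levS_neq l i x0 :
  uniq (unzip1 l) -> i < size l -> (nth x0 l i |: lev i l == lev i l) = false.
Proof.
move=> ul lt_i; apply/eqP=> E; have := notin_lev_S x0 ul lt_i.
by rewrite -E setU11.
Qed.

(* [Y_{j-1} <= Y_j <= Y_{j+1}] leaves two values for [Y_j], so negating the
   condition on level [m + j] moves the repetition one level down. *)
Lemma low_repeat_vanish l F j :
    uniq (unzip1 l) -> 0 < j -> j <= t -> j <= size l ->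
    (forall i, 0 < i < j -> F (m + i) =1 fun X => phi X == lev i l) ->
    F (m + j) =1 (fun X => phi X == lev j.-1 l) ->
  flag_parity flag F = false.
Proof.
move=> ul; elim: j F => // j IH F _ le_t le_l Fi Fj.
case: (posnP j) => [j0|j_gt0].
  (* [phi] would be empty at level [m + 1], against [phi_neq0]. *)
  apply: flag_parity0 => s fs; apply/negP=> /levelsP Fs.
  have le1 : m + 1 <= m + t by rewrite leq_add2l (leq_trans _ le_t).
  have : F (m + 1) (lev (m + 1) s) by apply: Fs; rewrite sizeW.
  rewrite j0 in Fj; rewrite Fj lev0 (negbTE (phi_lev_neq0 fs _)) //.
  by rewrite -addn1 leqnn.
have lt_mj : 0 < m + j <= m + t by rewrite addn_gt0 j_gt0 orbT leq_add2l ltnW.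
rewrite -(eq2_flag_parity (upd_id (m + j) F)) flag_parity_flip //.
transitivity (flag_parity flag (upd (m + j) (fun X => phi X == lev j.-1 l) F)).
  apply: eq_flag_parity => s fs; have /andP[_ le_mj] := lt_mj.
  rewrite !levels_upd ?sizeW //; case: (boolP (levels_off _ _ _)) => [off|].
    rewrite !andbT /= Fi ?j_gt0 //=.
    move/levels_offP: off => off.
    have Y1 : phi (lev (m + j.+1) s) = lev j l.
      apply/eqP; rewrite -[_ == _](Fj (lev (m + j.+1) s)); apply: off.
        by rewrite sizeW leq_add2l.
      by rewrite eqn_add2l gtn_eqF.
    have x0 : 'I_t * bool by case: (l) le_l.
    have E := lev_S x0 (leq_trans (eq_leq (prednK j_gt0)) (ltnW le_l)).
    have nE := levS_neq x0 ul (leq_trans (eq_leq (prednK j_gt0)) (ltnW le_l)).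
    rewrite prednK // in E; rewrite -E in nE.
    have Y2 : lev j.-1 l \subset phi (lev (m + j) s).
      case: (posnP j.-1) => [->|j1]; first by rewrite lev0 sub0set.
      have lt_j1 : j.-1 < j by rewrite prednK.
      suff <- : phi (lev (m + j.-1) s) = lev j.-1 l.
        by apply: phi_lev_sub; rewrite leq_add2l ltnW.
      apply/eqP; rewrite -[_ == _](Fi j.-1 _ (lev (m + j.-1) s)).
        apply: off; last by rewrite eqn_add2l ltn_eqF.
        by rewrite sizeW leq_add2l (leq_trans (ltnW lt_j1)) // ltnW.
      by rewrite j1 ltnW.
    have Y3 : phi (lev (m + j) s) \subset lev j l.
      by rewrite -Y1 phi_lev_sub // leq_add2l.
    rewrite E in Y3 nE *; case: (interval1 Y2 Y3) => ->; rewrite eqxx.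
      by rewrite eq_sym nE.
    by rewrite nE.
  by rewrite !andbF.
apply: (IH _ j_gt0) => [||i /andP[i_gt0 lt_i] X|X]; try exact: ltnW.
  by rewrite /upd eqn_add2l ltn_eqF // Fi // i_gt0 ltnW.
by rewrite /upd eqxx.
Qed.

(** A signed set uses each of the [t] colors at most once, so it has at most [t] elements. *)
Lemma full_lev_max l (Y : {set 'I_t * bool}) :
    uniq (unzip1 l) -> size l = t -> consistent Y ->
  lev t l \subset Y -> Y = lev t l.
Proof.
move=> ul sl con sub; apply/eqP; rewrite eq_sym eqEcard sub.
rewrite card_lev ?sl // -(card_in_imset con) (leq_trans (max_card _)) //.
by rewrite card_ord.
Qed.

(** Mirror image of [low_repeat_vanish]: each negation moves the repetition one level up. In the end
    level [m + t - 1] carries all [t] colors, and the negated top condition contradicts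
    maximality. *)
Lemma high_repeat_vanish l F j :
    uniq (unzip1 l) -> size l = t -> 0 < j -> j < t ->
    (forall i, j < i <= t -> F (m + i) =1 fun X => phi X == lev i l) ->
    F (m + j) =1 (fun X => phi X == lev j.+1 l) ->
  flag_parity flag F = false.
Proof.
move=> ul sl j_gt0 lt_jt.
have [k] := ubnP (t - j); elim: k => // k IH in j F j_gt0 lt_jt *.
rewrite ltnS => le_k Fi Fj.
have lt_mj : 0 < m + j.+1 <= m + t by rewrite addn_gt0 orbT leq_add2l.
have le_mj : m + j.+1 <= m + t by rewrite leq_add2l.
rewrite -(eq2_flag_parity (upd_id (m + j.+1) F)) flag_parity_flip //.
have Y0 s : levels_off (m + j.+1) F s -> phi (lev (m + j) s) = lev j.+1 l.
  move/levels_offP=> off; apply/eqP; rewrite -[_ == _]Fj; apply: off.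
    by rewrite sizeW leq_add2l ltnW.
  by rewrite eqn_add2l ltn_eqF.
have Y01 s : phi (lev (m + j) s) \subset phi (lev (m + j.+1) s).
  by apply: phi_lev_sub; rewrite leq_add2l.
move: (lt_jt); rewrite leq_eqVlt => /predU1P[jt|lt_j1].
  apply: flag_parity0 => s fs; rewrite levels_upd ?sizeW //.
  apply/negP=> /andP[] /=; rewrite Fi ?ltnSn //= => /eqP nE off; apply: nE.
  have := Y01 s; rewrite Y0 // jt; apply: full_lev_max => //.
  exact/phi_con/flag_con.
transitivity (flag_parity flag
    (upd (m + j.+1) (fun X => phi X == lev j.+2 l) F)).
  apply: eq_flag_parity => s fs.
  rewrite !levels_upd ?sizeW //; case: (boolP (levels_off _ _ _)) => [off|].
    rewrite !andbT /= Fi ?ltnSn //=; have := Y01 s; rewrite Y0 // => Y2.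
    have Y3 : phi (lev (m + j.+1) s) \subset lev j.+2 l.
      suff <- : phi (lev (m + j.+2) s) = lev j.+2 l.
        by apply: phi_lev_sub; rewrite leq_add2l.
      move/levels_offP: off => off.
      apply/eqP; rewrite -[_ == _](Fi j.+2 _ (lev (m + j.+2) s)).
        by apply: off; rewrite ?sizeW ?leq_add2l // eqn_add2l gtn_eqF.
      by rewrite lt_j1 andbT ltnW.
    have lt_l : j.+1 < size l by rewrite sl.
    have x0 : 'I_t * bool by case: (l) lt_l.
    have nE := levS_neq x0 ul lt_l.
    have E := lev_S x0 lt_l.
    rewrite E in Y3 nE *; case: (interval1 Y2 Y3) => ->; rewrite eqxx.
      by rewrite eq_sym nE.
    by rewrite nE.
  by rewrite !andbF.
apply: (IH j.+1) => // [|i /andP[lt_i le_i] X|X].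
- by rewrite (leq_trans _ le_k) // subnS prednK // subn_gt0.
- by rewrite /upd eqn_add2l gtn_eqF // Fi // le_i ltnW.
- by rewrite /upd eqxx.
Qed.

(** The conditions counted by the local degree: [H] up to level [m], and above it [phi] runs through
    the target flag encoded by [l]. *)
Definition chain (H : nat -> pred {set V * bool}) l i : pred {set V * bool} :=
  if i <= m then H i else fun X => phi X == lev (i - m) l.

Lemma lev_swap l1 x y l2 i : i != (size l1).+1 ->
  lev i (l1 ++ x :: y :: l2) = lev i (l1 ++ y :: x :: l2).
Proof.
move=> ni; apply: lev_perm; set s := _ ++ _; set s' := _ ++ _.
suff -> : s = swapn (size l1) s' by apply: perm_take_swapn.
by rewrite /s /s'; elim: (l1) => //= z l' ->.
Qed.

Lemma interval_eq (T : finType) (A B B' : {set T}) x y :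
    A \subset B -> A \subset B' ->
    B \subset y |: (x |: A) -> B' \subset y |: (x |: A) ->
  (B == B') = ((x \in B) == (x \in B')) && ((y \in B) == (y \in B')).
Proof.
move=> sB sB' uB uB'; apply/eqP/andP=> [-> // | [/eqP Ex /eqP Ey]].
apply/setP=> z; case: (eqVneq z x) => [-> //|nx].
case: (eqVneq z y) => [-> //|ny].
case: (boolP (z \in A)) => zA; first by rewrite (subsetP sB) ?(subsetP sB').
apply/idP/idP=> [/(subsetP uB)|/(subsetP uB')]; rewrite !inE.
  by rewrite (negbTE nx) (negbTE ny) (negbTE zA).
by rewrite (negbTE nx) (negbTE ny) (negbTE zA).
Qed.

Lemma lev_size_cat l1 l2 : lev (size l1) (l1 ++ l2) = [set z in l1].
Proof. by rewrite /lev take_size_cat. Qed.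

Lemma lev_size_catS l1 x l2 :
  lev (size l1).+1 (l1 ++ x :: l2) = x |: [set z in l1].
Proof.
apply/setP=> z; rewrite !inE take_cat ltnNge leqnSn /= subSnn /= take0.
by rewrite mem_cat inE orbC.
Qed.

Lemma lev_size_catSS l1 x y l2 :
  lev (size l1).+2 (l1 ++ x :: y :: l2) = y |: (x |: [set z in l1]).
Proof.
rewrite -cat_rcons -(size_rcons l1 x) lev_size_catS; congr (_ |: _).
by apply/setP=> z; rewrite !inE mem_rcons inE.
Qed.

(* Of the four sets between levels [k - 1] and [k + 1] of the target flag, the
   two equal to these levels contribute an even number of flags. *)
Lemma chain_swap H l1 x y l2 :
    let l := l1 ++ x :: y :: l2 in
    size l = t -> uniq (unzip1 l) ->
  flag_parity flag (chain H l) =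
    flag_parity flag (chain H (l1 ++ y :: x :: l2)).
Proof.
move=> l sl ul; set l' := _ ++ y :: _; set k := (size l1).+1.
have lt_k : k < t by rewrite -sl /l size_cat /= !addnS !ltnS leq_addr.
have le_mk : m + k <= m + t by rewrite leq_add2l ltnW.
have lt_mk : 0 < m + k <= m + t by rewrite addn_gt0 orbT.
have chainE j i : 0 < i -> chain H j (m + i) = fun X => phi X == lev i j.
  by move=> i_gt0; rewrite /chain leqNgt -{1}[m]addn0 ltn_add2l i_gt0 addKn.
pose A := [set z in l1].
pose R p := flag_parity flag (upd (m + k) p (chain H l)).
pose P B : pred {set V * bool} := fun X => phi X == B.
have Ql : flag_parity flag (chain H l) = R (P (x |: A)).
  apply: eq2_flag_parity => i X; rewrite /upd; case: eqP => // ->.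
  by rewrite chainE // /P /A -(lev_size_catS _ _ (y :: l2)).
have Ql' : flag_parity flag (chain H l') = R (P (y |: A)).
  apply: eq2_flag_parity => i X; rewrite /upd; case: eqP => [->|/eqP ni].
    by rewrite chainE // /P /A -(lev_size_catS _ _ (x :: l2)).
  rewrite /chain; case: leqP => // lt_i; rewrite lev_swap //.
  by rewrite -(eqn_add2l m) subnKC // ltnW.
have RA : R (P A) = false.
  apply: (@low_repeat_vanish l _ k) => //; first exact: ltnW.
  - by rewrite sl ltnW.
  - move=> i /andP[i_gt0 lt_i] X.
    by rewrite /upd eqn_add2l ltn_eqF // chainE.
  - by move=> X; rewrite /upd eqxx /= lev_size_cat.
have RxyA : R (P (y |: (x |: A))) = false.
  apply: (@high_repeat_vanish l _ k) => //.
  - move=> i /andP[lt_i le_i] X.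
    by rewrite /upd eqn_add2l gtn_eqF // chainE // (leq_trans _ lt_i).
  - by move=> X; rewrite /upd eqxx /= lev_size_catSS.
have R_split p q r : (forall X, p X = q X (+) r X) -> R p = R q (+) R r.
  by move=> pE; apply: flag_parity_split; rewrite ?sizeW // => s _ _.
have: R predT = false.
  by apply: free_flag; rewrite // sizeW.
(* [phi] at level [m + k] lies between [A] and [y |: (x |: A)], so exactly one of the four
   conditions holds. *)
have -> : R predT = R (fun X => P (x |: A) X (+) P (y |: A) X) (+)
                    R (fun X => P A X (+) P (y |: (x |: A)) X).
  apply: flag_parity_split; rewrite ?sizeW // => s fs /levels_offP off.
  have sAY : A \subset phi (lev (m + k) s).
    rewrite /A -(lev_size_cat l1 (x :: y :: l2)) -/l.
    case: (posnP (size l1)) => [->|l1_gt0]; first by rewrite lev0 sub0set.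
    suff <- : phi (lev (m + size l1) s) = lev (size l1) l.
      by apply: phi_lev_sub; rewrite leq_add2l.
    apply/eqP; have := off (m + size l1); rewrite chainE //; apply.
      by rewrite sizeW leq_add2l ltnW // ltnW.
    by rewrite eqn_add2l ltn_eqF.
  have sYB : phi (lev (m + k) s) \subset y |: (x |: A).
    rewrite /A -(lev_size_catSS _ _ _ l2) -/l.
    suff <- : phi (lev (m + k.+1) s) = lev k.+1 l.
      by apply: phi_lev_sub; rewrite leq_add2l.
    apply/eqP; have := off (m + k.+1); rewrite chainE //; apply.
      by rewrite sizeW leq_add2l.
    by rewrite eqn_add2l gtn_eqF.
  have /map_uniq : uniq (unzip1 l) := ul.
  rewrite cat_uniq /= !inE !negb_or.
  case/and3P=> _ /and3P[xl1 yl1 _] /and3P[/andP[xy _] _ _].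
  have sA : A \subset y |: (x |: A) by rewrite setUA subsetUr.
  have x_yxA : x \in y |: (x |: A) by rewrite !inE eqxx orbT.
  rewrite /P !(@interval_eq _ A _ _ x y) ?subsetU1 ?subUset ?sub1set ?setU11
    ?x_yxA ?sA //=.
  have -> : (y \in x |: A) = false.
    by rewrite !inE eq_sym (negbTE xy) (negbTE yl1).
  have -> : (x \in y |: A) = false by rewrite !inE (negbTE xy) (negbTE xl1).
  rewrite !inE (negbTE xl1) (negbTE yl1).
  by do 2!case: (_ \in phi _).
rewrite (R_split _ _ _ (fun X => erefl)) (R_split _ _ _ (fun X => erefl)).
rewrite RA RxyA !addbF -Ql -Ql'.
by case: flag_parity; case: flag_parity.
Qed.

(** Adjacent swaps carry [x] to the start of the target flag. *)
Lemma chain_front H l1 x l2 :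
    let l := l1 ++ x :: l2 in
    size l = t -> uniq (unzip1 l) ->
  flag_parity flag (chain H l) = flag_parity flag (chain H (x :: l1 ++ l2)).
Proof.
elim/last_ind: l1 l2 => [//|l1 z IH] l2 /=; rewrite !cat_rcons => sl ul.
rewrite chain_swap // IH //.
- by move: sl; rewrite !size_cat.
- have p : perm_eq (l1 ++ x :: z :: l2) (l1 ++ z :: x :: l2).
    by rewrite perm_cat2l; apply/permPl/(perm_catCA [:: x] [:: z]).
  by rewrite (perm_uniq (perm_map _ p)).
Qed.

(** * Alternating signs of the largest color *)

Definition mu X := \max_(x in phi X) x.1.+1.

(** [pick_sign] covers the sets without colors, so that the function is antipodal on all nonempty
    signed sets. *)
Definition top_sign X : bool :=
  if phi X == set0 then pick_sign X
  else [exists a : 'I_t, ((a, true) \in phi X) && (a.+1 == mu X)].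

Lemma top_sign_eq X a b : consistent X -> (a, b) \in phi X -> a.+1 = mu X ->
  top_sign X = b.
Proof.
move=> con aX Ea; rewrite /top_sign ifF; last first.
  by apply/negbTE/set0Pn; exists (a, b).
case: b aX => aX; first by apply/existsP; exists a; rewrite aX Ea eqxx.
apply/existsP=> -[a' /andP[a'X]]; rewrite -Ea eqSS => /eqP/val_inj E.
by have := consistent_neg (phi_con con) aX; rewrite -E a'X.
Qed.

Lemma top_signP X : consistent X -> phi X != set0 ->
  exists2 a, (a, top_sign X) \in phi X & a.+1 = mu X.
Proof.
move=> con X0; have: 0 < #|phi X| by rewrite card_gt0.
case/(eq_bigmax_cond (fun x : 'I_t * bool => x.1.+1)) => -[a b] abX Ea.
by exists a; rewrite // (top_sign_eq con abX).
Qed.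

Lemma leq_mu X x : x \in phi X -> x.1 < mu X.
Proof. by move=> xX; apply: (bigmax_sup x). Qed.

Lemma mu_leq X : mu X <= t.
Proof. by apply/bigmax_leqP=> -[a b] _; apply: ltn_ord. Qed.

Lemma mu_mono X Y : X \subset Y -> mu X <= mu Y.
Proof.
by move=> /phi_mono/subsetP sXY; apply/bigmax_leqP=> x /sXY; apply: leq_mu.
Qed.

Lemma mu_opps X : mu (@opps V @: X) = mu X.
Proof.
rewrite /mu phi_opps big_imset //=; exact: in2W (inv_inj (@oppsK _)).
Qed.

Lemma phi0_opps X : (phi (@opps V @: X) == set0) = (phi X == set0).
Proof. by rewrite phi_opps imset_eq0. Qed.

Lemma antipodal_top_sign : antipodal top_sign.
Proof.
move=> X X0 con; case: (eqVneq (phi X) set0) => [p0|p0].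
  by rewrite /top_sign phi0_opps p0 eqxx antipodal_pick_sign.
have [a aX Ea] := top_signP con p0.
apply: (@top_sign_eq _ a); rewrite ?mu_opps // ?phi_opps ?mem_opps /opps /=.
  move=> x y /imsetP[x' x'X ->] /imsetP[y' y'X ->] /= E.
  by rewrite (con _ _ x'X y'X E).
by rewrite negbK.
Qed.

(** A largest color that does not grow is the same color in [Y], and keeps its sign because [phi] is
    monotone. *)
Lemma mu_lt X Y : X \subset Y -> consistent Y -> phi X != set0 ->
  top_sign Y = ~~ top_sign X -> mu X < mu Y.
Proof.
move=> sXY conY X0 sg; have conX := consistent_sub sXY conY.
rewrite ltn_neqAle mu_mono // andbT; apply/eqP=> Emu.
have [a aX Ea] := top_signP conX X0.
have := top_sign_eq conY (subsetP (phi_mono sXY) _ aX); rewrite -Emu => /(_ Ea).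
by rewrite sg; case: top_sign.
Qed.

Lemma mu_alternate s i d : flag s -> phi (lev i s) != set0 ->
    (forall j, i <= j < i + d ->
       top_sign (lev j.+1 s) = ~~ top_sign (lev j s)) ->
  mu (lev i s) + d <= mu (lev (i + d) s).
Proof.
move=> fs p0; elim: d => [|d IH] alt; first by rewrite !addn0.
rewrite !addnS (leq_ltn_trans (IH _)) // => [j /andP[ij lt_j]|].
  by apply: alt; rewrite ij addnS ltnW.
apply: mu_lt; rewrite ?lev_mono //; first exact: flag_con.
  apply: contraNneq p0 => E; rewrite -subset0 -E phi_lev_sub //.
  exact: leq_addr.
by apply: alt; rewrite leq_addr addnS ltnSn.
Qed.

(** The target flag forced by alternation: color [a], counted from 0, enters at level [m + a + 1]
    with the sign prescribed there. *)
Definition alt_chain b : seq ('I_t * bool) :=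
  [seq (a, b (+) odd (m + a.+1)) | a : 'I_t <- enum 'I_t].

Lemma mem_lev_alt_chain b j (x : 'I_t * bool) : (x \in lev j (alt_chain b)) =
  (x.1 < j) && (x.2 == b (+) odd (m + x.1.+1)).
Proof.
have mem_take_enum (a : 'I_t) : (a \in take j (enum 'I_t)) = (a < j).
  rewrite -(mem_map (@ord_inj t)) map_take val_enum_ord take_iota mem_iota /=.
  by rewrite leq_min ltn_ord andbT.
rewrite inE -map_take; apply/mapP/andP=> [[a aj ->]|[lt_j /eqP E]] /=.
  by rewrite -mem_take_enum aj eqxx.
by exists x.1; rewrite ?mem_take_enum // -E; case: (x).
Qed.

(** From level [m + 1] to [m + t] each sign change raises [mu], which stays between 1 and [t], so
    [mu] is [j] at level [m + j]. This fixes the largest color of each level and its sign, and by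
    monotonicity it remains in all higher levels. *)
Lemma alt_chainP b s : flag s ->
    (forall i, m < i <= m + t -> top_sign (lev i s) = b (+) odd i) <->
    (forall i, m < i <= m + t -> phi (lev i s) = lev (i - m) (alt_chain b)).
Proof.
move=> fs; split=> [alt i lt_i|chn i lt_i].
  have muE j : 0 < j <= t -> mu (lev (m + j) s) = j.
    case/andP=> j_gt0 le_j; have lt_m1 : m < m.+1 <= m + t by lia.
    have mu1 : 0 < mu (lev m.+1 s).
      case/set0Pn: (phi_lev_neq0 fs lt_m1) => x /leq_mu.
      exact: leq_ltn_trans.
    have alt' i' : m < i' < m + t ->
        top_sign (lev i'.+1 s) = ~~ top_sign (lev i' s).
      by move=> lt_i'; rewrite !alt /= ?addbN //; lia.
    have low : mu (lev m.+1 s) + j.-1 <= mu (lev (m.+1 + j.-1) s).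
      apply: mu_alternate => // [|i' lt_i']; last by apply: alt'; lia.
      exact: phi_lev_neq0.
    have high : mu (lev (m + j) s) + (t - j) <= mu (lev (m + j + (t - j)) s).
      apply: mu_alternate => // [|i' lt_i']; last by apply: alt'; lia.
      by apply: phi_lev_neq0 => //; lia.
    have := mu_leq (lev (m + j + (t - j)) s).
    by move: low; rewrite addSnnS prednK //; lia.
  have top (a : 'I_t) : (a, b (+) odd (m + a.+1)) \in phi (lev (m + a.+1) s).
    have lt_ma : m < m + a.+1 <= m + t.
      by rewrite -addn1 !leq_add2l ltn_ord.
    have [a' a'X Ea'] := top_signP (flag_con fs) (phi_lev_neq0 fs lt_ma).
    rewrite muE ?ltn_ord // in Ea'; case: Ea' => /val_inj Ea'.
    by rewrite -alt // -{1}Ea'.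
  have lt_im : 0 < i - m <= t by rewrite subn_gt0 leq_subLR.
  have le_mi : m <= i by case/andP: lt_i => /ltnW.
  have sub (a : 'I_t) : a < i - m ->
      phi (lev (m + a.+1) s) \subset phi (lev i s).
    by move=> lt_a; rewrite phi_lev_sub // -(subnKC le_mi) leq_add2l.
  apply/setP=> -[a c]; rewrite mem_lev_alt_chain /=; apply/idP/andP.
    move=> aX; have lt_a : a < i - m.
      by rewrite -(muE (i - m)) // subnKC // (leq_mu aX).
    split=> //; have aX' := subsetP (sub a lt_a) _ (top a).
    by have [->] := phi_con (flag_con fs) aX aX' erefl.
  by case=> lt_a /eqP ->; apply: (subsetP (sub a lt_a)).
have [lt_m le_i] := andP lt_i.
have [a aX Ea] := top_signP (flag_con fs) (phi_lev_neq0 fs lt_i).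
move: (aX); rewrite chn // mem_lev_alt_chain /= => /andP[lt_a /eqP ->].
(* For the converse, color [i - m - 1] occurs at level [i] and is the largest one there. *)
have lt_k : (i - m).-1 < t by rewrite prednK ?subn_gt0 // leq_subLR.
have := @leq_mu (lev i s) (Ordinal lt_k, b (+) odd (m + (i - m))).
rewrite chn // mem_lev_alt_chain /= prednK ?subn_gt0 // leqnn eqxx -Ea.
by move=> /(_ isT) le_a; congr (_ (+) odd _); lia.
Qed.

(** Each flag has exactly one member at level [k], so the counts for all [S] add up to an odd
    number. *)
Lemma flag_parity_level F k : k <= m + t -> flag_parity flag F ->
  exists S, flag_parity flag (upd k (fun X => F k X && (X == S)) F).
Proof.
move=> le_k Fodd; apply/xor_exists.
rewrite exchange_big /=; suff <- : flag_parity flag F =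
  \big[addb/false]_s \big[addb/false]_S
    (flag s && levels (upd k (fun X => F k X && (X == S)) F) s) by [].
apply: eq_bigr => s _.
rewrite (bigD1 (lev k s)) //= big1 => [|S /negbTE nS].
  rewrite addbF levels_upd ?sizeW // eqxx andbT -levels_upd ?sizeW //.
  by congr (_ && _); apply: eq_forallb => i; rewrite upd_id.
by rewrite levels_upd ?sizeW // eq_sym nS !andbF.
Qed.

(** Fan's lemma yields [S] as level [m] of an odd number of alternating flags. Changing the signs
    above level [m] and reordering the target flag keep this number odd, so for each [x] some flag
    through [S] has image [[set x]] at the next level. *)
Lemma signed_vertex_exists : exists S : {set V * bool},
  [/\ consistent S, phi S = set0 &
      forall x, exists2 y,
        forall b, (y.1, b) \notin S & phi (y |: S) = [set x]].
Proof.
have le_m : m <= m + t by apply: leq_addr.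
have leW i : i <= m + t -> i <= size W by rewrite sizeW.
have := @fan _ _ _ odd uW antipodal_top_sign.
case/(flag_parity_level le_m) => S; set H := upd m _ _ => Hodd.
exists S; have [s fs /levelsP Hs] := flag_parity_exists Hodd.
have HS s' i : i <= m -> H i (lev i s') -> i = m -> lev m s' = S.
  by move=> _ + Ei; rewrite Ei /H /upd eqxx => /andP[_ /eqP].
have sS : lev m s = S by apply: HS (Hs m _) _; rewrite ?sizeW.
have conS : consistent S by rewrite -sS; apply: flag_con.
(* A member of [phi set0] would come with its opposite. *)
have phi_set0 : phi set0 = set0.
  apply/setP=> x; rewrite inE; apply/negP=> x0.
  have con0 : consistent (set0 : {set V * bool}) by move=> y z; rewrite inE.
  have := consistent_neg (phi_con con0) (_ : (x.1, x.2) \in _).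
  rewrite -surjective_pairing => /(_ x0); rewrite -[(_, _)]/(opps x) -mem_opps.
  by rewrite -phi_opps imset0 x0.
have alt i : 0 < i <= m + t -> top_sign (lev i s) = odd i.
  case/andP=> i_gt0 le_i; have := Hs i (leW _ le_i).
  rewrite /H /upd; case: eqP => [<-|_]; rewrite /word gtn_eqF //=.
    by case/andP=> /eqP.
  by move/eqP.
split=> //.
  (* If [phi S] were nonempty, [mu] would be at least 1 at level [m] and grow in each of the [t]
     steps above it, past [t]. The first step alternates only if [m > 0], as [word] is silent on
     level 0. *)
  apply/eqP/negPn/negP=> S0; have m_gt0 : 0 < m.
    by rewrite lt0n; apply: contraNneq S0 => m0; rewrite -sS m0 lev0 phi_set0.
  rewrite -sS in S0; have mu_m : 0 < mu (lev m s).
    by case/set0Pn: S0 => x /leq_mu; apply: leq_ltn_trans.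
  have: mu (lev m s) + t <= mu (lev (m + t) s).
    apply: mu_alternate => // k lt_k; rewrite !alt //; lia.
  have := mu_leq (lev (m + t) s); lia.
(* This [b] makes [(a, c)] an entry of [alt_chain b]. If it holds, [Hb] negates the conditions above
   level [m]; those up to [m], with the choice of [S], are kept. *)
move=> [a c]; pose b := c (+) odd (m + a.+1).
pose Hb i : pred {set V * bool} :=
  if i <= m then H i else fun X => top_sign X == b (+) odd i.
have Hb_odd : flag_parity flag Hb.
  rewrite -(@flag_parity_signs _ _ (fun k => b && (m < k)) _ H) //.
    move=> k le_k /andP[_ lt_k].
    by apply: free_flag; rewrite ?(leq_trans _ lt_k).
  move=> k _ X; rewrite /Hb leqNgt; case: ltnP => lt_k; rewrite ?andbF //=.
  rewrite andbT /H /upd gtn_eqF // /word gtn_eqF ?(leq_trans _ lt_k) //=.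
  by case: (b) (top_sign X) (odd k) => [] [] [].
have chain_odd : flag_parity flag (chain H (alt_chain b)).
  suff <- : flag_parity flag Hb = flag_parity flag (chain H (alt_chain b)).
    by [].
  apply: eq_flag_parity => s' fs'.
  apply/levelsP/levelsP=> Hs' i le_i.
    have := Hs' i le_i; rewrite /chain /Hb; case: leqP => // lt_i _.
    apply/eqP; apply: (proj1 (alt_chainP b fs')); last by rewrite lt_i -sizeW.
    move=> j /andP[lt_j le_j]; have := Hs' j (leW _ le_j).
    by rewrite /Hb leqNgt lt_j => /eqP.
  have := Hs' i le_i; rewrite /chain /Hb; case: leqP => // lt_i _.
  apply/eqP; apply: (proj2 (alt_chainP b fs')); last by rewrite lt_i -sizeW.
  move=> j /andP[lt_j le_j]; have := Hs' j (leW _ le_j).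
  by rewrite /chain leqNgt lt_j => /eqP.
have ac_in : (a, c) \in alt_chain b.
  by apply/mapP; exists a; rewrite ?mem_enum // /b -addbA addbb addbF.
have sz : size (alt_chain b) = t by rewrite size_map size_enum_ord.
have un : uniq (unzip1 (alt_chain b)).
  by rewrite /unzip1 -map_comp map_id enum_uniq.
case/splitPr: ac_in chain_odd sz un => l1 l2 chain_odd sz un.
rewrite chain_front // in chain_odd.
have [s' fs' /levelsP Hs'] := flag_parity_exists chain_odd.
have t_gt0 : m < m + t.
  by rewrite -addn1 leq_add2l (leq_ltn_trans _ (ltn_ord a)).
have sS' : lev m s' = S.
  by have := Hs' m (leW _ le_m); rewrite /chain leqnn => /HS; apply.
have lt_sz : m < size s' by rewrite size_tuple sizeW.
have x0 : V * bool by case: (tval s') lt_sz.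
(* The element that the flag adds to [S] at level [m + 1]. *)
exists (nth x0 s' m).
  move=> c'; apply/negP=> y_in; have := notin_lev_S x0 (flag_uniq fs') lt_sz.
  case/negP; suff <- : (((nth x0 s' m).1, c') = nth x0 s' m) by rewrite sS'.
  apply: (@flag_con s' m.+1 fs'); rewrite ?(lev_S x0) // sS' !inE.
    by rewrite y_in orbT.
  by rewrite eqxx.
rewrite -sS' -lev_S //; have := Hs' m.+1 (leW _ t_gt0).
rewrite /chain ltnn subSnn => /eqP ->; apply/setP=> z.
by rewrite in_set1 inE /= take0 mem_seq1.
Qed.

End Chen.

(** * Signed colors of a Kneser graph *)

Section SignedColors.
Variables (H : hypergraph) (t : nat) (c : KG H -> 'I_t).
Hypothesis c_proper : proper_coloring c.
Implicit Types (X Y : {set hvertex H * bool}) (e f : kneser_vertex H).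

(** This is the [phi] to which the local degree argument is applied. *)
Definition signed_colors X : {set 'I_t * bool} :=
  [set x : 'I_t * bool | [exists e : kneser_vertex H,
     (c e == x.1) && [forall v in val e, (v, x.2) \in X]]].

Lemma signed_colorsP X a b :
  reflect (exists2 e, c e = a & forall v, v \in val e -> (v, b) \in X)
          ((a, b) \in signed_colors X).
Proof.
rewrite inE; apply: (iffP existsP) => [[e /andP[/eqP ce /forall_inP eX]]|].
  by exists e.
by case=> e ce eX; exists e; rewrite ce eqxx; apply/forall_inP.
Qed.

Lemma same_color_meet e f : c e = c f -> ~~ [disjoint val e & val f].
Proof.
move=> cef; apply/negP=> ef; move/forallP/(_ e)/forallP/(_ f): c_proper.
by rewrite cef eqxx implybF => /negP[].
Qed.

Lemma signed_colors_mono X Y : X \subset Y ->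
  signed_colors X \subset signed_colors Y.
Proof.
move=> /subsetP sXY; apply/subsetP=> -[a b] /signed_colorsP[e ce eX].
by apply/signed_colorsP; exists e => // v /eX /sXY.
Qed.

(** Two edges of the same color meet, and a common vertex would carry both signs. *)
Lemma signed_colors_consistent X : consistent X -> consistent (signed_colors X).
Proof.
move=> con [a b] [a' b'] /signed_colorsP[e ce eX] /signed_colorsP[f cf fX] /= E.
rewrite -E in cf *; congr (_, _); case: (eqVneq b b') => // nb.
case/negP: (same_color_meet (etrans ce (esym cf))); apply/pred0P=> v /=.
apply/andP=> -[/eX vX /fX vX']; case/eqP: nb.
by have [] := con _ _ vX vX' erefl.
Qed.

Lemma signed_colors_opps X :
  signed_colors (@opps _ @: X) = @opps _ @: signed_colors X.
Proof.
apply/setP=> -[a b]; rewrite mem_opps /opps /=.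
apply/signed_colorsP/signed_colorsP=> -[e ce eX]; exists e => // v /eX.
  by rewrite mem_opps.
by rewrite mem_opps /opps.
Qed.

(** The set [U] of unsigned vertices has fewer than [cd2 H] elements, so the signs, read as a
    2-coloring, leave an edge avoiding [U] monochromatic. *)
Lemma signed_colors_neq0 X : consistent X -> #|hvertex H| < cd2 H + #|X| ->
  signed_colors X != set0.
Proof.
move=> con ltX; pose U := ~: (fst @: X).
have: ~~ two_colorable (edges_avoiding U).
  apply/negP=> U2; move: ltX; rewrite /cd2; case: ex_minnP => k _ min_k ltX.
  have: k <= #|U| by apply: min_k; apply/existsP; exists U; rewrite U2 eqxx.
  have := cardsC (fst @: X); rewrite card_in_imset // -/U.
  by move: #|_| #|U| #|X| ltX => n u x; lia.
move/existsPn/(_ [ffun v => inord ((v, true) \in X)])/forall_inPn => [e].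
rewrite inE negbK => /andP[eH /eqP eU] /existsP[a /forall_inP ea].
pose b := a == inord 1 :> 'I_2.
pose e' : kneser_vertex H := exist _ e eH.
apply/set0Pn; exists (c e', b); apply/signed_colorsP; exists e' => //= v ve.
have /imsetP[[v' b'] vX /= Ev] : v \in fst @: X.
  apply: contraTT isT => nv; have: v \in e :&: U by rewrite !inE ve nv.
  by rewrite eU inE.
rewrite -{v'}Ev in vX; suff -> : b = b' by [].
have := ea v ve; rewrite ffunE /b => /eqP <-; case: b' vX => vX.
  by rewrite vX eqxx.
rewrite (negbTE (consistent_neg con vX)); apply/negbTE/eqP=> /(congr1 val) /=.
by rewrite !inordK.
Qed.

Lemma cd2_leq : cd2 H <= #|hvertex H|.
Proof.
rewrite /cd2; case: ex_minnP => k _; apply; apply/existsP.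
exists setT; rewrite cardsT eqxx andbT; apply/existsP; exists [ffun=> ord0].
apply/forall_inP=> e; rewrite inE setIT => /andP[eE /eqP e0].
by move: (hedges_nonempty H); rewrite -e0 eE.
Qed.

End SignedColors.

(** * The colorful copy *)

Theorem corollary1 (H : hypergraph) (t : nat)
    (H_nonempty : hedges H != set0)
    (H_no_singleton : forall e, e \in hedges H -> #|e| != 1)
    (chi_eq : chromatic_number (KG H) = t)
    (cd2_eq : cd2 H = t)
    (c : KG H -> 'I_t) (c_proper : proper_coloring c) :
  exists f : Kstar t -> KG H,
    [/\ colorful_copy c f,
        forall a : 'I_t, exists i : 'I_t, c (f (inl i)) = a
      & forall a : 'I_t, exists i : 'I_t, c (f (inr i)) = a].
Proof.
have le_t := cd2_leq H; rewrite cd2_eq in le_t.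
have sizeW : size (enum (hvertex H)) = #|hvertex H| - t + t.
  by rewrite -cardE subnK.
have neq0 X : consistent X -> #|hvertex H| - t < #|X| ->
    signed_colors c X != set0.
  by move=> con ltX; apply: signed_colors_neq0 => //; rewrite cd2_eq; lia.
have [S [conS S0 ySx]] := signed_vertex_exists (enum_uniq _) sizeW
  (@signed_colors_mono H t c) (@signed_colors_consistent H t c c_proper)
  (@signed_colors_opps H t c) neq0.
have edge_ex (x : 'I_t * bool) : exists u : kneser_vertex H * hvertex H,
    [/\ c u.1 = x.1, forall b, (u.2, b) \notin S,
        forall v, v \in val u.1 -> v = u.2 \/ (v, x.2) \in S
      & signed_colors c ((u.2, x.2) |: S) = [set x]].
  have [y yS yx] := ySx x; have: x \in signed_colors c (y |: S).
    by rewrite yx inE.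
  case: x yx => a b yx /signed_colorsP[e ce eS].
  (* With the opposite sign at [y], the edge would lie inside [S], which has no signed colors. *)
  have Eb : y.2 = b.
    apply/eqP/negPn/negP=> nb; have: (a, b) \in signed_colors c S.
      apply/signed_colorsP; exists e => // v /eS.
      by rewrite !inE => /predU1P[E|//]; rewrite -E eqxx in nb.
    by rewrite S0 inE.
  exists (e, y.1); split=> //= [v /eS|]; last first.
    by rewrite -yx -{1}Eb -surjective_pairing.
  by rewrite !inE => /predU1P[<-|]; [left | right].
have {edge_ex} [u uP] := fin_all_exists edge_ex.
pose e x := (u x).1; pose v x := (u x).2.
have cE x : c (e x) = x.1 by have [] := uP x.
have vS x b : (v x, b) \notin S by have [_ /(_ b)] := uP x.
have eS x z : z \in val (e x) -> z = v x \/ (z, x.2) \in S.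
  by have [_ _ + _] := uP x; apply.
have vcolors x : signed_colors c ((v x, x.2) |: S) = [set x] by have [] := uP x.
have notS z : (z, true) \in S -> (z, false) \in S -> False.
  by move=> /consistent_neg -/(_ conS)/negP.
(* Edges on opposite sides could share only a vertex that has both signs in [S], an added vertex
   that lies in [S], or a common added vertex. *)
have disj a a' : v (a, true) != v (a', false) ->
    [disjoint val (e (a, true)) & val (e (a', false))].
  move=> nv; apply/pred0P=> z /=; apply/andP=> -[/eS[]zt /eS[]zf].
  - by case/eqP: nv; rewrite -zt -zf.
  - by have := vS (a, true) false; rewrite -zt zf.
  - by have := vS (a', false) true; rewrite -zf zt.
  - exact: notS zt zf.
have v_eq a : v (a, true) = v (a, false).
  apply/eqP/negPn/negP=> /disj; apply/negP/(same_color_meet c_proper).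
  by rewrite !cE.
(* Adding one positive vertex to [S] creates a single signed color, so the vertex determines the
   color. *)
have v_inj a a' : v (a, true) = v (a', true) -> a = a'.
  move=> E; have := vcolors (a, true); rewrite E (vcolors (a', true)).
  by move/setP/(_ (a, true)); rewrite !inE eqxx => /eqP[].
pose f (w : Kstar t) : KG H :=
  match w with inl i => e (i, true) | inr i => e (i, false) end.
have cf w : c (f w) = match w with inl i => i | inr i => i end.
  by case: w => i; rewrite /f cE.
(* A common edge could contain only [v (i, true)], but edges are neither empty nor singletons. *)
have neq i : e (i, true) <> e (i, false).
  move=> E; have eH := valP (e (i, true)).
  have sub : val (e (i, true)) \subset [set v (i, true)].
    apply/subsetP=> z zt; rewrite inE; apply/eqP.
    have zf := zt; rewrite E in zf.
    case/eS: zt => // zt; case/eS: zf => [->|zf]; first by rewrite v_eq.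
    by case: (notS _ zt zf).
  have := H_no_singleton _ eH; have := subset_leq_card sub; rewrite cards1.
  rewrite leq_eqVlt ltnS leqn0 cards_eq0 => /orP[-> //|/eqP e0].
  by move: (hedges_nonempty H); rewrite -e0 eH.
have disjE i j : i != j -> [disjoint val (e (i, true)) & val (e (j, false))].
  by move=> ij; apply: disj; rewrite -v_eq; apply: contraNneq ij => /v_inj ->.
exists f; split; first split.
- split=> [w w' E | [i|i] [j|j] //= ij].
  (* Equal images have equal colors, hence equal indices; [neq] then separates the two sides. *)
  + move: (congr1 c E); rewrite !cf.
    case: w w' E => [i|i] [j|j] /= E Eij; rewrite -Eij in E *; try by [].
      by case: (neq _ E).
    by case: (neq _ (esym E)).
  + exact: disjE.
  + by rewrite /kneser_rel disjoint_sym disjE // eq_sym.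
- by move=> a; exists (inl a); rewrite cf.
- by move=> a; exists a; rewrite cf.
- by move=> a; exists a; rewrite cf.
Qed.
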